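(* Let $0<\alpha<1$. For a generic $f\in C_1^{\alpha}[0,1]$, for all $A\subset[0,1]$: (1) if $f|_A\in C^{\beta}(A)$ for some $\alpha<\beta\le1$, then $\dim_{\mathcal H}A\le1-\beta$; (2) if $V^{\beta}(f|_A)<\infty$ for some $\beta>0$, then $\dim_{\mathcal H}A\le\max\{\alpha\beta,\ \beta/(\beta+1)\}$.
   Context: $C_1^{\alpha}[0,1]$ is the set of functions $f\colon[0,1]\to\mathbb R$ with $|f(x)-f(y)|\le|x-y|^{\alpha}$ for all $x,y\in[0,1]$, endowed with the maximum metric; it is a complete metric space. ''For a generic $f\in C_1^{\alpha}[0,1]$'' property $\mathcal P$ holds means that the set of $f\in C_1^{\alpha}[0,1]$ having property $\mathcal P$ is co-meager, i.e. its complement is a countable union of nowhere dense sets. Here $\mathcal P$ is the conjunction of (1) and (2) for all $A$ and all $\beta$ simultaneously. For non-empty $A\subset[0,1]$ and $\beta>0$, $C^{\beta}(A)$ is the set of $\beta$-Hölder continuous functions $f\colon A\to\mathbb R$, i.e. those for which there is $c\in(0,\infty)$ with $|f(x)-f(y)|\le c|x-y|^{\beta}$ for all $x,y\in A$. The $\beta$-variation of $f\colon A\to\mathbb R$ is \[ V^{\beta}(f)=\sup\left\{\sum_{i=1}^{n}|f(x_i)-f(x_{i-1})|^{\beta}:\ x_0<\dots<x_n,\ x_i\in A,\ n\in\mathbb N^+\right\}. \] $\dim_{\mathcal H}$ is Hausdorff dimension. *)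

(* Defs.v *)
From HB Require Import structures.
From mathcomp Require Import all_boot all_order all_algebra.
From mathcomp Require Import all_classical all_reals all_analysis.
From mathcomp Require Import ring lra.

Set Implicit Arguments.
Unset Strict Implicit.
Unset Printing Implicit Defensive.

Import Order.TTheory GRing.Theory Num.Theory.
Import numFieldNormedType.Exports.

Local Open Scope classical_set_scope.
Local Open Scope ring_scope.

Section category.
Context {T : topologicalType}.

Definition nowhere_dense (N : set T) : Prop := (closure N)° = set0.

Definition meager (M : set T) : Prop :=
  exists F : nat -> set T,
    (forall n, nowhere_dense (F n)) /\ M = \bigcup_n F n.

Definition comeager (P : set T) : Prop := meager (~` P).

End category.

(* The inclusion of subtypes, so that [f \o set_incl AB] is the restriction
   to [A] of [f : B -> _]. *)
Definition set_incl {T : Type} {A B : set T} (AB : A `<=` B) (x : A) : B :=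
  exist _ (val x) (mem_set (AB _ (set_mem (valP x)))).

Section functions_on_subsets.
Context {R : realType} {A : set R}.

Definition holder_on (beta : R) (g : A -> R) : Prop :=
  exists c : R, 0 < c /\
    forall x y : A, `|g x - g y| <= c * `|val x - val y| `^ beta.

(* Only the values [x i] with [i <= n] are relevant. *)
Definition power_variation (beta : R) (g : A -> R) : \bar R :=
  ereal_sup [set v | exists (n : nat) (x : nat -> A),
    [/\ (0 < n)%N,
        forall i, (i < n)%N -> val (x i) < val (x i.+1) &
        v = (\sum_(1 <= i < n.+1) `|g (x i) - g (x i.-1)| `^ beta)%:E]].

End functions_on_subsets.

Section hausdorff_dimension.
Context {R : realType}.
Implicit Types A U : set R.
Local Open Scope ereal_scope.

Definition diameter U : \bar R :=
  ereal_sup [set v | exists x y, [/\ U x, U y & v = `|x - y|%:E]].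

(* The [s]-th power of the diameter, with value [0] at the empty set; for a
   nonempty set and [s = 0] the value is [1]. *)
Definition diameter_pow (s : R) U : \bar R :=
  if `[< U = set0 >] then 0 else poweR (diameter U) s.

Definition hausdorff_premeasure (s delta : R) A : \bar R :=
  ereal_inf [set v | exists U : nat -> set R,
    [/\ A `<=` \bigcup_n U n,
        forall n, diameter (U n) <= delta%:E &
        v = \sum_(0 <= n <oo) diameter_pow s (U n)]].

Definition hausdorff_measure (s : R) A : \bar R :=
  ereal_sup [set hausdorff_premeasure s delta A
            | delta in [set delta : R | (0 < delta)%R]].

(* With this definition the empty set has dimension [0]. *)
Definition hausdorff_dim A : \bar R :=
  ereal_inf [set s%:E | s in [set s : R | (0 <= s)%R /\
                                          hausdorff_measure s A = 0]].

End hausdorff_dimension.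

Section holder_space.
Context {R : realType} {alpha : R}.

(* The hypothesis [0 < alpha] makes these functions bounded, so that the
   supremum distance below is a metric; for [alpha < 0] it need not be. *)
Definition holder1 (alpha_gt0 : 0 < alpha) : Type :=
  set_type [set f : `[0%R, 1%R]%classic -> R |
    forall x y, `|f x - f y| <= `|val x - val y| `^ alpha].

Variable alpha_gt0 : 0 < alpha.
Local Notation C := (holder1 alpha_gt0).

Definition holder1_fun (f : C) : `[0%R, 1%R]%classic -> R := val f.

Lemma holder1P (f : C) x y :
  `|holder1_fun f x - holder1_fun f y| <= `|val x - val y| `^ alpha.
Proof. by case: f => f /= fP; exact: (set_mem fP). Qed.

(* These functions are continuous on [[0, 1]], so the supremum is attained. *)
Definition max_dist (f g : C) : R :=
  sup (range (fun x => `|holder1_fun f x - holder1_fun g x|)).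

Let mem01 : (0 : R) \in (`[0, 1]%classic : set R).
Proof. by apply: mem_set => /=; rewrite in_itv /= lexx ler01. Qed.

Let zero01 : `[0%R, 1%R]%classic := exist _ 0 mem01.

Let holder1_close (f : C) x y : `|holder1_fun f x - holder1_fun f y| <= 1.
Proof.
apply: le_trans (holder1P f x y) _.
suff h : `|val x - val y| <= 1.
  have := ge0_ler_powR (ltW alpha_gt0) (x := `|val x - val y|) (y := 1).
  by rewrite powR1; apply; rewrite ?nnegrE.
case: x => x /= /set_mem /=; case: y => y /= /set_mem /=.
rewrite !in_itv /= => /andP[y0 y1] /andP[x0 x1].
by rewrite ler_norml; apply/andP; split; lra.
Qed.

Lemma max_dist_has_sup (f g : C) :
  has_sup (range (fun x => `|holder1_fun f x - holder1_fun g x|)).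
Proof.
split; first by exists `|holder1_fun f zero01 - holder1_fun g zero01|, zero01.
exists (1 + `|holder1_fun f zero01 - holder1_fun g zero01| + 1) => _ [x _ <-].
have -> : holder1_fun f x - holder1_fun g x =
    (holder1_fun f x - holder1_fun f zero01) +
    (holder1_fun f zero01 - holder1_fun g zero01) +
    (holder1_fun g zero01 - holder1_fun g x) by ring.
apply: le_trans (ler_normD _ _) _; apply: lerD (holder1_close _ _ _).
by apply: le_trans (ler_normD _ _) _; apply: lerD (holder1_close _ _ _) _.
Qed.

Lemma le_max_dist (f g : C) x :
  `|holder1_fun f x - holder1_fun g x| <= max_dist f g.
Proof.
by apply: ub_le_sup; [exact: (max_dist_has_sup f g).2 | exists x].
Qed.

Lemma max_dist_le (f g : C) (r : R) :
  (forall x, `|holder1_fun f x - holder1_fun g x| <= r) -> max_dist f g <= r.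
Proof.
move=> h; apply: ge_sup; first exact: (max_dist_has_sup f g).1.
by move=> _ [x _ <-].
Qed.

Let max_distxx (f : C) : max_dist f f = 0.
Proof.
apply/eqP; rewrite eq_le; apply/andP; split.
  by apply: max_dist_le => x; rewrite subrr normr0.
exact: le_trans (normr_ge0 _) (le_max_dist f f zero01).
Qed.

Let max_dist_positivity (f g : C) : max_dist f g = 0 -> f = g.
Proof.
move=> fg; apply: val_inj; apply/funext => x.
apply/eqP; rewrite -subr_eq0 -normr_eq0 eq_le normr_ge0 andbT.
by apply: le_trans (le_max_dist f g x) _; rewrite fg.
Qed.

Let max_dist_sym (f g : C) : max_dist f g = max_dist g f.
Proof.
by congr (sup _); apply: eq_imagel => x _; rewrite distrC.
Qed.

Let max_dist_triangle (g f h : C) : max_dist f h <= max_dist f g + max_dist g h.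
Proof.
apply: max_dist_le => x.
rewrite -(subrKA (holder1_fun g x)).
apply: le_trans (ler_normD _ _) _.
by apply: lerD; exact: le_max_dist.
Qed.

HB.instance Definition _ := Choice.on C.
HB.instance Definition _ := isMetric.Build R C
  max_distxx max_dist_positivity max_dist_sym max_dist_triangle.

End holder_space.

Coercion holder1_fun : holder1 >-> Funclass.

(* Main.v *)
Require Import Defs.
From HB Require Import structures.
From mathcomp Require Import all_boot all_order all_algebra.
From mathcomp Require Import all_classical all_reals all_analysis.
From mathcomp Require Import ring lra zify.

(** A generic function is, for every [m], uniformly close to a Lipschitz function
    plus a sum of triangle waves at rapidly decreasing scales
    [l_0 > l_1 > ... > l_m], with an error that may be chosen as small as desired
    in terms of that sum. The wave at scale [l] has height [l `^ a] and slope
    [l `^ (a - 1)], with [a] slightly above [alpha] so that adding it hardly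
    changes the Hoelder constant.

    Consider the cells [[k * l_i, (k + 1) * l_i)] and distances at least
    [d_i = l_i `^ (1 + v)], where [v > 0] is a parameter. On a cell the [i]-th wave
    is affine. Coarser waves are much flatter, and finer waves are lower than its
    rise over the distance [d_i] as soon as [l_(i+1) = l_i `^ (1 + v / alpha)]. So
    the function behaves on the cell, at distances at least [d_i], like an affine
    function of slope about [l_i `^ (a - 1)].

    If a set [A] is covered by intervals of length [d_(i-1)], each of them meets
    about [d_(i-1) / l_i] cells, and within a cell the part of [A] is covered by
    few intervals of length [d_i]. If the restriction to [A] is [beta]-Hoelder,
    one interval suffices when [v + a < beta * (1 + v)]: steepness and the Hoelder
    condition contradict each other at distances above [d_i]. If the restriction
    has finite [beta]-variation, the number of intervals in excess of one per
    cell is, over all cells together, [O(l_i `^ (- beta * (a + v)))], because each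
    excess interval costs [l_i `^ (beta * (a + v))] of variation
    ([few_stays_holder], [few_stays_variation], [refine_cover]).

    Iterating along the scales ([iterate_refine_cover]), the [s]-dimensional size
    of the cover tends to [0] if [s > (1 - alpha) / (1 + v)] and, in the second
    case, [s > beta * (a + v) / (1 + v)]. Optimizing over [v], with [a] tending to
    [alpha], gives exactly [1 - beta] and [max (alpha * beta) (beta / (beta + 1))]
    ([holder_parameters], [variation_parameters]).

    Steepness at the scales [0] to [m], tested at distances at least [d_i] only,
    is stable under small uniform perturbations, and it can be achieved
    arbitrarily close to any function ([exists_steep]). Its failure is therefore
    nowhere dense, and rational [v], [a] and all [m] give countably many such
    conditions. *)

Set Implicit Arguments.
Unset Strict Implicit.
Unset Printing Implicit Defensive.

Import Order.TTheory GRing.Theory Num.Theory.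
Import numFieldNormedType.Exports.

Local Open Scope classical_set_scope.
Local Open Scope ring_scope.

(** * Covers by cells *)

Section Covering.
Context {R : realType}.
Implicit Types (A : set R) (s xs : seq R) (l d D : R).

Definition cell l (x : R) : int := Num.floor (x / l).

Definition covers A s d := forall x, A x -> exists2 c, c \in s & `|x - c| <= d.

Definition cell_separated l d xs := forall x y, x \in xs -> y \in xs ->
  x != y -> cell l x = cell l y -> d <= `|x - y|.

(** Counts the consecutive pairs of [xs] that lie in a common cell; for sorted
    [xs] this is the excess of the number of points over the number of cells
    that they occupy. *)
Definition stays l xs : nat :=
  \sum_(1 <= i < size xs) (cell l xs`_i == cell l xs`_i.-1).

(** The only way in which the restricted function enters the covering argument:
    steepness together with regularity on [A] leaves few stays. *)
Definition few_stays A l d (E : R) := forall xs, sorted <%R xs ->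
  {in xs, forall x, A x} -> cell_separated l d xs -> (stays l xs)%:R <= E.

Lemma le_cell l x y : 0 < l -> x <= y -> cell l x <= cell l y.
Proof. by move=> l0 xy; rewrite /cell; apply: le_floor; rewrite ler_pM2r ?invr_gt0. Qed.

Lemma stays_cons2 l x y xs :
  stays l [:: x, y & xs] = ((cell l y == cell l x) + stays l (y :: xs))%N.
Proof.
rewrite /stays big_ltn //= big_add1; congr (_ + _)%N.
by apply: eq_big_nat => -[].
Qed.

Lemma size_cells_stays l xs : 0 < l -> sorted <%R xs ->
  size xs = (size (undup (map (cell l) xs)) + stays l xs)%N.
Proof.
move=> l0; elim: xs => [|x [|y xs] IH]; first by rewrite /stays /= big_geq.
  by rewrite /stays /= big_geq.
move=> /andP[xy yxs]; rewrite stays_cons2.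
rewrite -[LHS]/((size (y :: xs)).+1) (IH yxs) /=.
have [yx|nyx] := eqVneq (cell l y) (cell l x).
  by rewrite yx inE eqxx /= addnCA add1n.
have -> : (cell l x \in cell l y :: map (cell l) xs) = false.
  apply/negP => /(@mapP _ _ _ (y :: xs))[z zxs xz].
  have yz : y <= z.
    move: zxs; rewrite inE => /predU1P[->//|zxs].
    by apply/ltW; apply: (allP (order_path_min lt_trans yxs)).
  by move/eqP: nyx; apply; apply/le_anti; rewrite {1}xz !le_cell // ltW.
by [].
Qed.

(** An interval of length [2 * D] meets at most [2 * D / l + 2] cells. *)
Lemma size_cells A s D l xs : 0 < l -> 0 < D -> covers A s D ->
  {in xs, forall x, A x} ->
  (size (undup (map (cell l) xs)))%:R <= (size s)%:R * (2 * D / l + 2).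
Proof.
move=> l0 D0 sA xsA; set k := Num.truncn (2 * D / l); pose n := k.+2.
pose t := flatten [seq [seq cell l (c - D) + k%:Z | k <- iota 0 n] | c <- s].
have szt : size t = (size s * n)%N.
  rewrite /t; elim: s {t sA} => //= c s IH.
  by rewrite size_cat IH size_map size_iota mulSn.
have : (size (undup (map (cell l) xs)) <= size t)%N.
  apply: uniq_leq_size; first exact: undup_uniq.
  move=> z; rewrite mem_undup => /mapP[x xxs ->].
  have [c cs xc] := sA x (xsA x xxs).
  apply/flattenP; eexists; first by apply/mapP; exists c; [exact: cs|].
  have lo : cell l (c - D) <= cell l x.
    by apply: le_cell => //; rewrite lerBlDr; move: xc; rewrite ler_norml; lra.
  apply/mapP; exists `|cell l x - cell l (c - D)|%N; last first.
    by rewrite gez0_abs ?subr_ge0// subrKC.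
  rewrite mem_iota add0n -ltz_nat gez0_abs ?subr_ge0//=.
  rewrite ltrBlDr -[ltLHS]/(Num.floor _) floor_lt_int.
  rewrite intrD -pmulrn.
  have h1 : (c - D) / l < (cell l (c - D) + 1)%:~R by exact: floorD1_gt.
  have h2 : 2 * D / l < k.+1%:R by exact: truncnS_gt.
  have h3 : x / l <= (c - D) / l + 2 * D / l.
    rewrite -mulrDl ler_pM2r ?invr_gt0//; move: xc; rewrite ler_norml; lra.
  move: h1 h2 h3; rewrite intrD /n -(natr1 k.+1); lra.
rewrite -(ler_nat R) => /le_trans; apply.
rewrite szt natrM ler_wpM2l //.
have : k%:R <= 2 * D / l.
  by rewrite -truncn_ge_nat// divr_ge0 ?ltW// mulr_gt0.
by rewrite /n -!natr1; lra.
Qed.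

(** The new centers are a maximal set of points of [A] such that points in a
    common cell are [d] apart; maximality makes it a [d]-cover. Sorting it, each
    step to the next point either changes cell, which happens at most as often
    as there are cells near the old cover, or is one of the few stays. *)
Lemma refine_cover A s D l d (E : R) : 0 < l -> 0 < D -> 0 <= d -> covers A s D ->
  few_stays A l d E ->
  exists2 s', covers A s' d & (size s')%:R <= (size s)%:R * (2 * D / l + 2) + E.
Proof.
move=> l0 D0 d0 sA hE.
pose B := (size s)%:R * (2 * D / l + 2) + E.
pose good xs := [/\ uniq xs, {in xs, forall x, A x} & cell_separated l d xs].
have bound xs : good xs -> (size xs)%:R <= B.
  move=> [u xsA sep]; set ys := sort <=%R xs.
  have mys : ys =i xs by move=> z; rewrite mem_sort.
  have ysort : sorted <%R ys.
    by rewrite lt_sorted_uniq_le sort_uniq u sort_le_sorted.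
  have ysA : {in ys, forall x, A x} by move=> x; rewrite mys; exact: xsA.
  rewrite -(size_sort <=%R xs) (size_cells_stays l0 ysort) natrD.
  apply: lerD; first exact: size_cells sA ysA.
  by apply: hE => // x y; rewrite !mys; exact: sep.
pose P n := `[< exists2 xs, good xs & size xs = n >].
have P0 : exists n, P n by exists 0%N; apply/asboolP; exists [::].
have PB n : P n -> (n <= Num.truncn B)%N.
  move=> /asboolP[xs gxs <-]; have := bound _ gxs => xB.
  by rewrite truncn_ge_nat//; apply: le_trans xB.
case: (ex_maxnP P0 PB) => n /asboolP[xs gxs szn] nmax.
exists xs; last exact: bound.
move=> x Ax; apply: contrapT => nc.
have far y : y \in xs -> d < `|x - y|.
  by move=> yxs; rewrite ltNge; apply/negP => h; apply: nc; exists y.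
case: gxs => u xsA sep.
have [xxs|xxs] := boolP (x \in xs).
  by have := far x xxs; rewrite subrr normr0 ltNge d0.
suff : good (x :: xs).
  move=> g; have := nmax (size (x :: xs)).
  rewrite [size _]/= szn ltnn => h; suff : false by []; apply: h.
  by apply/asboolP; exists (x :: xs); rewrite //= szn.
split; first by rewrite /= xxs u.
  by move=> y; rewrite inE => /predU1P[->|/xsA].
move=> y z; rewrite !inE => /predU1P[->|yxs] /predU1P[->|zxs].
- by rewrite eqxx.
- by move=> _ _; rewrite ltW ?far.
- by move=> _ _; rewrite distrC ltW ?far.
- exact: sep.
Qed.

End Covering.

(** * Hausdorff dimension from covers by equal intervals *)

Section HausdorffDimension.
Context {R : realType}.
Implicit Types A : set R.

Lemma hausdorff_measure_eq0 A (s : R) : 0 < s ->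
  (forall e : R, 0 < e -> exists t d, [/\ 0 < d, d <= e, covers A t d &
     (size t)%:R * d `^ s <= e]) ->
  hausdorff_measure s A = 0%E.
Proof.
move=> s0 hA; apply/eqP; rewrite eq_le; apply/andP; split; last first.
  apply: (@le_trans _ _ (hausdorff_premeasure s 1 A)).
    apply: le_ereal_inf_tmp => _ [U [_ _ ->]]; apply: nneseries_ge0 => n _ _.
    by rewrite /diameter_pow; case: ifP => // _; exact: poweR_ge0.
  by apply: ereal_sup_ubound; exists 1 => //=.
apply: ge_ereal_sup => _ [delta /= delta0 <-].
apply/lee_addgt0Pr => e e0; rewrite add0e.
(* An interval of radius [d] has diameter [2 * d], hence the halving of the
   scale and the factor [2 `^ s]. *)
pose e' := Num.min (delta / 2) (e / 2 `^ s).
have p2 : 0 < 2 `^ s :> R by rewrite powR_gt0.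
have e'0 : 0 < e' by rewrite lt_min !divr_gt0.
have [t [d [d0 de tA td]]] := hA e' e'0.
move: de td; rewrite !le_min => /andP[ddelta _] /andP[_ td].
pose U n := if (n < size t)%N then `[t`_n - d, t`_n + d]%classic else set0.
have U2d n : (diameter (U n) <= (2 * d)%:E)%E.
  apply: ge_ereal_sup => _ [x [y [Ux Uy ->]]]; rewrite lee_fin.
  move: Ux Uy; rewrite /U; case: ifP => //= _; rewrite !in_itv /= ler_norml.
  by lra.
have Upow n : (diameter_pow s (U n) <=
    (if (n < size t)%N then (2 * d) `^ s else 0)%:E)%E.
  rewrite /diameter_pow; case: asboolP => [_|/eqP/set0P[x Ux]].
    by rewrite lee_fin; case: ifP => // _; exact: powR_ge0.
  have -> : (n < size t)%N by move: Ux; rewrite /U; case: ifP.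
  rewrite -poweR_EFin (gt0_ler_poweR (ltW s0)) //.
    rewrite in_itv /= leey andbT; apply: ereal_sup_ubound.
    by exists x, x; rewrite subrr normr0.
  by rewrite in_itv /= leey andbT lee_fin mulr_ge0 // ltW.
apply: (@le_trans _ _ (\sum_(0 <= n <oo) diameter_pow s (U n))%E).
  apply: ereal_inf_lbound; exists U; split => //.
    move=> x /tA[c ct xc]; exists (index c t) => //.
    rewrite /U index_mem ct /= in_itv /= nth_index //.
    by move: xc; rewrite ler_norml; lra.
  by move=> n; apply: le_trans (U2d n) _; rewrite lee_fin; lra.
have pow0 n : (0 <= diameter_pow s (U n))%E.
  by rewrite /diameter_pow; case: ifP => // _; exact: poweR_ge0.
apply: lime_le; first by apply: is_cvg_nneseries.
apply: nearW => k.
apply: (@le_trans _ _ ((minn k (size t))%:R * (2 * d) `^ s)%:E).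
  elim: k => [|k IH]; first by rewrite big_geq // lee_fin min0n mul0r.
  rewrite big_nat_recr //=; apply: le_trans (leeD IH (Upow k)) _.
  rewrite -EFinD lee_fin; have [kt|kt] := ltnP k (size t).
    by rewrite (minn_idPl kt) -(natr1 k) (mulrDl k%:R) mul1r.
  by rewrite (minn_idPr (leqW kt)) addr0.
rewrite lee_fin powRM ?(ltW d0)// mulrCA (mulrC (2 `^ s)) -ler_pdivlMr //.
apply: le_trans td; rewrite ler_wpM2r ?powR_ge0// ler_nat geq_minr //.
Qed.

Lemma hausdorff_dim_le A (b : R) : 0 <= b ->
  (forall t : R, b < t -> hausdorff_measure t A = 0%E) ->
  (hausdorff_dim A <= b%:E)%E.
Proof.
move=> b0 hA; apply/lee_addgt0Pr => e e0.
apply: ereal_inf_lbound; exists (b + e) => //=; split.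
  by rewrite addr_ge0 // ltW.
by apply: hA; rewrite ltrDl.
Qed.

End HausdorffDimension.

(** * Stays of restrictions of steep functions *)

Section Stays.
Context {R : realType}.
Implicit Types (A : set R) (F : R -> R) (xs : seq R).

(** Increments over a distance at least [d] within a cell have the size that
    slope [K] gives; short distances are left out so that the property survives
    a small uniform perturbation of [F]. *)
Definition steep A F (l d K : R) := forall x y, A x -> A y ->
  cell l x = cell l y -> d <= `|x - y| -> K * `|x - y| <= `|F x - F y|.

Lemma steepS A B F l d K : A `<=` B -> steep B F l d K -> steep A F l d K.
Proof. by move=> AB st x y /AB Bx /AB By; exact: st. Qed.

Lemma consecutive_dist xs (l d : R) i : sorted <%R xs -> cell_separated l d xs ->
  (0 < i)%N -> (i < size xs)%N -> cell l xs`_i = cell l xs`_i.-1 ->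
  [/\ xs`_i \in xs, xs`_i.-1 \in xs & d <= `|xs`_i - xs`_i.-1|].
Proof.
move=> sxs sep i0 isz same.
have i1 : (i.-1 < size xs)%N by apply: leq_ltn_trans isz; exact: leq_pred.
have xi : xs`_i \in xs by rewrite mem_nth.
have xj : xs`_i.-1 \in xs by rewrite mem_nth.
split=> //; apply: sep => //.
rewrite nth_uniq ?(sorted_uniq lt_trans ltxx) // gtn_eqF //.
by rewrite ltn_predL.
Qed.

(** Two points of [A] in a cell at distance [t >= d] would satisfy
    [K * t <= c * t `^ b], which fails once [c < K * d `^ (1 - b)]: there are no
    stays at all. *)
Lemma few_stays_holder A F (l d K b c : R) : 0 < d -> 0 <= K -> b <= 1 ->
  c < K * d `^ (1 - b) -> steep A F l d K ->
  (forall x y, A x -> A y -> `|F x - F y| <= c * `|x - y| `^ b) ->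
  few_stays A l d 0.
Proof.
move=> d0 K0 b1 cK st hF xs sxs xsA sep.
rewrite lern0 /stays big_nat big1 // => i /andP[i0 isz].
apply/eqP; rewrite eqb0; apply/eqP => same.
have [xi xj dt] := consecutive_dist sxs sep i0 isz same.
have := le_trans (st _ _ (xsA _ xi) (xsA _ xj) same dt)
  (hF _ _ (xsA _ xi) (xsA _ xj)).
set t := `|_ - _| in dt *; have t0 : 0 < t by apply: lt_le_trans dt.
apply/negP; rewrite -ltNge.
have tE : t = t `^ (1 - b) * t `^ b.
  by rewrite -powRD ?(gt_eqF t0) ?implybT // subrK powRr1 // ltW.
rewrite [X in K * X]tE mulrA ltr_pM2r ?powR_gt0 //.
apply: lt_le_trans cK _; rewrite ler_wpM2l //.
by rewrite ge0_ler_powR ?nnegrE ?subr_ge0 ?(ltW d0) ?(ltW t0).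
Qed.

(** Each stay contributes at least [(K * d) `^ b] to the [b]-variation. *)
Lemma few_stays_variation A F (l d K b M : R) : 0 < d -> 0 < K -> 0 < b ->
  steep A F l d K ->
  (forall xs, sorted <%R xs -> {in xs, forall x, A x} ->
    \sum_(1 <= i < size xs) `|F xs`_i - F xs`_i.-1| `^ b <= M) ->
  few_stays A l d (M * (K * d) `^ (- b)).
Proof.
move=> d0 K0 b0 st hM xs sxs xsA sep.
rewrite powRN ler_pdivlMr ?powR_gt0 ?mulr_gt0 //.
apply: le_trans (hM xs sxs xsA); rewrite /stays natr_sum mulr_suml.
rewrite !big_nat; apply: ler_sum => i /andP[i0 isz].
have [same|_] := eqVneq; last by rewrite mul0r powR_ge0.
have [xi xj dt] := consecutive_dist sxs sep i0 isz same.
rewrite mul1r ge0_ler_powR ?nnegrE ?(ltW b0) ?mulr_ge0 ?(ltW K0) ?(ltW d0) //.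
apply: le_trans (st _ _ (xsA _ xi) (xsA _ xj) same dt).
by rewrite ler_pM2l.
Qed.

End Stays.

(** * Iterating the refinement along geometric scales *)

Section Scales.
Context {R : realType}.
Implicit Types (A : set R) (F : R -> R) (al v q : R).

(** The ratio [1 + v / al] of the exponents is the smallest one for which a wave
    of height [l' `^ al] at the next scale [l' = l `^ (1 + v / al)] is no higher
    than the rise [l `^ (al - 1) * l `^ (1 + v) = l `^ (al + v)] of the present
    wave, of slope [l `^ (al - 1)], over a distance [l `^ (1 + v)]. *)
Definition scale al v q (i : nat) : R := q `^ ((1 + v / al) ^+ i).

Lemma scale_gt0 al v q i : 0 < q -> 0 < scale al v q i.
Proof. exact: powR_gt0. Qed.

Lemma scale0 al v q : 0 < q -> scale al v q 0 = q.
Proof. by move=> q0; rewrite /scale expr0 powRr1 // ltW. Qed.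

Lemma scaleS al v q i :
  scale al v q i.+1 = scale al v q i `^ (1 + v / al).
Proof. by rewrite /scale exprSr powRrM. Qed.

Lemma scale_homo al v q i j : 0 < al -> 0 < v -> 0 < q -> q < 1 ->
  (i <= j)%N -> scale al v q j <= scale al v q i.
Proof.
move=> al0 v0 q0 q1 ij; rewrite /scale ger_powR ?q0 ?(ltW q1) //.
by rewrite ler_weXn2l // lerDl divr_ge0 // ltW.
Qed.

Lemma scale_le al v q i : 0 < al -> 0 < v -> 0 < q -> q < 1 ->
  scale al v q i <= q.
Proof. by move=> *; rewrite -[leRHS](scale0 al v) // scale_homo. Qed.

Lemma scale_powR_le al v q (r : R) i : 0 < al -> 0 < v -> 0 < q -> q < 1 ->
  0 <= r -> scale al v q i `^ r <= q `^ r.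
Proof.
move=> al0 v0 q0 q1 r0; apply: ge0_ler_powR => //.
- exact/ltW/scale_gt0.
- exact: ltW.
- exact: scale_le.
Qed.

Lemma powR_le1 (x r : R) : 0 < x -> x <= 1 -> 0 <= r -> x `^ r <= 1.
Proof.
by move=> x0 x1 r0; rewrite -[leRHS](powRr0 x) ger_powR // x0 x1.
Qed.

(** Let [P_i] be the number of intervals in the cover of radius
    [d_i = l_i `^ (1 + v)], times [d_i `^ s]. Passing from [d_i] to [d_(i+1)]
    multiplies the number of intervals by at most [4 * d_i / l_(i+1)], which
    amounts to [P_(i+1) <= 4 * l_i `^ eta * P_i + B], with
    [eta = v / al * (s * (1 + v) - (1 - al))]. So [P_i] contracts precisely when
    [s > (1 - al) / (1 + v)]. *)
Lemma iterate_refine_cover al v q (s : R) A (E : nat -> R) (B : R) m :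
  0 < al -> 0 < v -> 0 < q -> q < 1 -> 0 < s -> 0 <= B ->
  A `<=` `[0, 1] ->
  4 * q `^ (v / al * (s * (1 + v) - (1 - al))) <= 2^-1 ->
  0 < s * (1 + v) - (1 - al) ->
  al < 1 ->
  (forall i, (i <= m)%N ->
    few_stays A (scale al v q i) (scale al v q i `^ (1 + v)) (E i) /\
    E i * (scale al v q i `^ (1 + v)) `^ s <= B) ->
  exists2 t, covers A t (scale al v q m `^ (1 + v)) &
    (size t)%:R * (scale al v q m `^ (1 + v)) `^ s <=
    (4 * q `^ (v / al * (s * (1 + v) - (1 - al)))) ^+ m * (4 / q) + 2 * B.
Proof.
have half_step (X Y : R) : X <= 2^-1 * Y -> 2 * X + Y <= 2 * Y by lra.
have factor4 (X : R) : 1 <= X -> 2 * X + 2 <= 4 * X by lra.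
have double (X : R) : 0 <= X -> X <= 2 * X by lra.
move=> al0 v0 q0 q1 s0 B0 A01; set eta := v / al * _; set lam := 4 * _.
move=> lam2 eta0 al1.
have lam0 : 0 <= lam by rewrite mulr_ge0 ?powR_ge0.
elim: m => [|m IH] hE.
  have [fs Bd] := hE 0%N (leqnn _).
  have c0 : covers A [:: 0] 1.
    move=> x /A01 /=; rewrite in_itv /= => /andP[x0 x1].
    by exists 0; rewrite ?inE // subr0 ger0_norm.
  have [t tA szt] :=
    refine_cover (scale_gt0 al v 0 q0) ltr01 (powR_ge0 _ _) c0 fs.
  exists t => //; rewrite expr0 mul1r.
  apply: le_trans (_ : (4 / q + E 0%N) * (scale al v q 0 `^ (1 + v)) `^ s <= _).
    rewrite ler_wpM2r ?powR_ge0 //; apply: le_trans szt _.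
    by rewrite scale0 // mul1r mulr1 lerD2r factor4 // invf_ge1 // ltW.
  rewrite mulrDl; apply: lerD; last exact: le_trans Bd (double _ B0).
  rewrite ler_piMr ?divr_ge0 ?(ltW q0) // -powRrM powR_le1 ?scale_gt0 //.
    by apply: le_trans (scale_le _ _ _ _ _) (ltW q1).
  by rewrite mulr_ge0 ?(ltW s0) // addr_ge0 // ltW.
have [t tA szt] := IH (fun i im => hE i (leqW im)).
have [fs Bd] := hE m.+1 (leqnn _).
have [t' t'A szt'] := refine_cover (scale_gt0 al v m.+1 q0)
  (powR_gt0 _ (scale_gt0 al v m q0)) (powR_ge0 _ _) tA fs.
exists t' => //.
set l := scale al v q m in tA szt szt' *; set l' := scale al v q m.+1 in fs Bd szt' *.
have l0 : 0 < l by apply: scale_gt0.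
have l1 : l <= 1 by apply: le_trans (scale_le _ _ _ _ _) (ltW q1).
have l'0 : 0 < l' by apply: scale_gt0.
have l'E : l' = l `^ (1 + v / al) by rewrite /l' scaleS.
have lq : l <= q by apply: scale_le.
have dl : l' <= l `^ (1 + v).
  rewrite l'E ger_powR ?l0 // lerD2l ler_pdivlMr // ler_piMr ?ltW //.
clearbody l l'.
apply: le_trans (ler_wpM2r (powR_ge0 _ s) szt') _.
rewrite mulrDl.
apply: le_trans (_ : lam * ((size t)%:R * (l `^ (1 + v)) `^ s) + B <= _); last first.
  rewrite exprS; apply: le_trans (_ : lam * (lam ^+ m * (4 / q) + 2 * B) + B <= _).
    by rewrite lerD2r ler_wpM2l.
  rewrite mulrDr mulrA -addrA lerD2l.
  by rewrite mulrCA half_step // ler_wpM2r.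
apply: lerD => //.
rewrite [leRHS]mulrCA -[leLHS]mulrA; apply: ler_wpM2l; first exact: ler0n.
have dl1 : 1 <= l `^ (1 + v) / l' by rewrite ler_pdivlMr // mul1r.
apply: le_trans (_ : 4 * (l `^ (1 + v) / l') * (l' `^ (1 + v)) `^ s <= _).
  by rewrite ler_wpM2r ?powR_ge0 // -mulrA factor4.
have lne : l != 0 by rewrite gt_eqF.
rewrite l'E -powRN -!powRrM -mulrA -!powRD ?lne ?implybT //.
rewrite /lam -[leRHS]mulrA ler_wpM2l //.
apply: (@le_trans _ _ (l `^ eta * l `^ ((1 + v) * s))).
  rewrite -powRD ?lne ?implybT // le_eqVlt; apply/orP; left; apply/eqP.
  congr (_ `^ _); rewrite /eta; field. by rewrite gt_eqF.
rewrite ler_wpM2r ?powR_ge0 // ge0_ler_powR ?nnegrE ?(ltW l0) ?(ltW q0) //.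
by rewrite /eta mulr_ge0 ?divr_ge0 // ltW.
Qed.

Lemma near0_powR_lt (r e : R) : 0 < r -> 0 < e -> \forall q \near 0^'+, q `^ r < e.
Proof. by move=> r0 e0; have /cvgr_lt := @powR_cvg0 R r r0; exact. Qed.

Lemma near0_ex (P : R -> Prop) : (\forall q \near 0^'+, P q) ->
  exists2 Q, 0 < Q & forall q, 0 < q -> q < Q -> P q.
Proof.
move=> [Q /= Q0 hQ]; exists Q => // q q0 qQ; apply: hQ => //=.
by rewrite sub0r normrN gtr0_norm.
Qed.

(** The first cover costs a factor [4 / q], which the contraction beats after a
    number of steps that depends on [eta] only; this is why [n] is chosen before
    the initial scale [q]. *)
Lemma hausdorff_measure_eq0_stays al v (s : R) A (C e0 : R) :
  0 < al -> al < 1 -> 0 < v -> 0 < s -> 0 <= C -> A `<=` `[0, 1] ->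
  1 - al < s * (1 + v) -> e0 < s * (1 + v) ->
  (forall (n : nat) (Q : R), 0 < Q ->
    exists q, [/\ 0 < q, q < Q & forall i, (i <= n)%N ->
    few_stays A (scale al v q i) (scale al v q i `^ (1 + v))
      (C * scale al v q i `^ (- e0))]) ->
  hausdorff_measure s A = 0%E.
Proof.
move=> al0 al1 v0 s0 C0 A01 sv es hq.
pose eta := v / al * (s * (1 + v) - (1 - al)).
have eta0 : 0 < eta by rewrite mulr_gt0 ?divr_gt0 ?subr_gt0.
have eta2 : 0 < eta / 2 by rewrite divr_gt0.
pose e1 := s * (1 + v) - e0.
have e1_gt0 : 0 < e1 by rewrite subr_gt0.
apply: hausdorff_measure_eq0 => // e e_gt0.
(* With this [n] the factor [q `^ (n * eta / 2)] is at most [q ^+ 2]; the other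
   half of [eta] pays for the constant [4] of each step. *)
pose n := (Num.truncn (4 / eta)).+1.
have n2 : 2 <= eta / 2 * n%:R.
  have : 4 / eta < n%:R by exact: truncnS_gt.
  rewrite ltr_pdivrMr // => h.
  by rewrite -(ler_pM2l (ltr0Sn R 1)) mulrA (mulrC 2 (eta / 2)) divfK // mulrC; lra.
have C1 : 0 < 2 * C + 1 by lra.
have [Q Q0 hQ] : exists2 Q : R, 0 < Q & forall q, 0 < q -> q < Q ->
    [/\ q < 1, q < e / 8, q `^ (eta / 2) < 8^-1 & 2 * C * q `^ e1 < e / 2].
  apply: near0_ex; near=> q; split.
  - by near: q; exact: nbhs_right_lt.
  - by near: q; apply: nbhs_right_lt; rewrite divr_gt0.
  - by near: q; apply: near0_powR_lt.
  - apply: le_lt_trans (_ : (2 * C + 1) * q `^ e1 < _).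
      by rewrite ler_wpM2r ?powR_ge0 // lerDl ler01.
    rewrite mulrC -ltr_pdivlMr //.
    by near: q; apply: near0_powR_lt => //; rewrite ?divr_gt0.
have [q [q0 qQ few]] := hq n Q Q0.
have [q1 qe qeta qC] := hQ q q0 qQ.
have qne : q != 0 by rewrite gt_eqF.
have lam_le : 4 * q `^ eta <= q `^ (eta / 2).
  have -> : q `^ eta = q `^ (eta / 2) * q `^ (eta / 2).
    by rewrite -powRD ?qne ?implybT // -splitr.
  rewrite mulrA ler_piMl ?powR_ge0 //; lra.
have [t tA szt] : exists2 t, covers A t (scale al v q n `^ (1 + v)) &
    (size t)%:R * (scale al v q n `^ (1 + v)) `^ s <=
    (4 * q `^ eta) ^+ n * (4 / q) + 2 * (C * q `^ e1).
  apply: (iterate_refine_cover (E := fun i => C * scale al v q i `^ (- e0))) => //.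
  - by rewrite mulr_ge0 ?powR_ge0.
  - by apply: le_trans lam_le _; lra.
  - by rewrite subr_gt0.
  move=> i ii; split; first exact: few.
  have l0 : 0 < scale al v q i by exact: scale_gt0.
  rewrite -powRrM -mulrA ler_wpM2l // -powRD ?(gt_eqF l0) ?implybT //.
  have -> : - e0 + (1 + v) * s = e1 by rewrite /e1; ring.
  by apply: scale_powR_le => //; exact: ltW.
exists t, (scale al v q n `^ (1 + v)); split => //.
- by rewrite powR_gt0 // scale_gt0.
- apply: le_trans (_ : q <= _); last by lra.
  apply: le_trans (scale_le n al0 v0 q0 q1).
  have ln0 : 0 < scale al v q n by exact: scale_gt0.
  have ln1 : scale al v q n <= 1.
    by apply: le_trans (scale_le _ _ _ _ _) (ltW q1).
  by rewrite ge1r_powR ?ln0 ?lerDl // ltW.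
- apply: le_trans szt _.
  have : (4 * q `^ eta) ^+ n <= q ^+ 2.
    apply: le_trans (_ : (q `^ (eta / 2)) ^+ n <= _).
      by rewrite lerXn2r // nnegrE ?mulr_ge0 ?powR_ge0.
    rewrite -powR_mulrn ?powR_ge0 // -powRrM -powR_mulrn ?(ltW q0) //.
    by rewrite ger_powR // q0 ltW.
  have q40 : 0 <= 4 / q by rewrite divr_ge0 // ltW.
  move=> /(ler_wpM2r q40) h.
  have q4 : q ^+ 2 * (4 / q) = 4 * q by field.
  rewrite q4 in h; rewrite mulrA; lra.
Unshelve. all: by end_near. Qed.

End Scales.

(** * Lipschitz approximation *)

Section Lipschitz.
Context {R : realType}.
Implicit Types F G : R -> R.

Definition holder F (c al : R) := forall x y, `|F x - F y| <= c * `|x - y| `^ al.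

Definition lipschitz F (L : R) := forall x y, `|F x - F y| <= L * `|x - y|.

(** The infimal convolution [G x = inf_t (F (x + t) + L * |t|)] is [L]-Lipschitz,
    and it inherits every modulus of continuity of [F] because it is an infimum
    of translates of [F]. *)
Lemma lipschitz_approx F (al e : R) : 0 < al -> al < 1 -> 0 < e ->
  holder F 1 al ->
  exists G L, [/\ 0 <= L, lipschitz G L, holder G 1 al &
    forall x, `|F x - G x| <= e].
Proof.
move=> al0 al1 e0 hF.
have al1' : 0 < 1 - al by rewrite subr_gt0.
(* [L] is the slope at which [L * t] overtakes [t `^ al] at [t = d], where
   [t `^ al] is [e]. *)
pose d := e `^ al^-1.
have d0 : 0 < d by exact: powR_gt0.
have dE : d `^ al = e by rewrite /d -powRrM mulVf ?gt_eqF // powRr1 // ltW.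
pose L := (d `^ (1 - al))^-1.
have L0 : 0 < L by rewrite invr_gt0 powR_gt0.
have key (t : R) : `|t| `^ al <= e + L * `|t|.
  have [td|td] := leP `|t| d.
    apply: le_trans (_ : e <= _); last by rewrite lerDl mulr_ge0 // ltW.
    by rewrite -dE ge0_ler_powR ?nnegrE ?(ltW al0) ?(ltW d0).
  have t0 : 0 < `|t| by apply: lt_trans td.
  apply: le_trans (_ : L * `|t| <= _); last by rewrite lerDr ltW.
  rewrite /L mulrC ler_pdivlMr ?powR_gt0 //.
  apply: le_trans (_ : `|t| `^ al * `|t| `^ (1 - al) <= _).
    rewrite ler_wpM2l ?powR_ge0 // ge0_ler_powR ?nnegrE ?(ltW al1') ?(ltW d0) //.
    exact: ltW.
  by rewrite -powRD ?(gt_eqF t0) ?implybT // subrKC powRr1.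
pose S x := range (fun t => F (x + t) + L * `|t|).
have lb x t : F x - e <= F (x + t) + L * `|t|.
  have := hF x (x + t); rewrite opprD addNKr normrN mul1r => h.
  by have := key t; move: h; rewrite ler_norml => /andP[_]; lra.
have Sinf x : has_inf (S x).
  split; first by exists (F (x + 0) + L * `|0 : R|), 0.
  by exists (F x - e) => _ [t _ <-]; exact: lb.
pose G x := inf (S x).
have Gle x t : G x <= F (x + t) + L * `|t|.
  by apply: ge_inf; [exact: (Sinf x).2 | exists t].
have Gcmp (x y c : R) :
    (forall t, exists t', F (x + t') + L * `|t'| <= F (y + t) + L * `|t| + c) ->
    G x <= G y + c.
  move=> h; rewrite -lerBlDr; apply: lb_le_inf; first exact: (Sinf y).1.
  move=> _ [t _ <-]; rewrite lerBlDr; have [t' ht'] := h t.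
  exact: le_trans (Gle x t') ht'.
have two_sided (c : R -> R -> R) : (forall x y, c x y = c y x) ->
    (forall x y, G x <= G y + c x y) -> forall x y, `|G x - G y| <= c x y.
  move=> csym h x y; have := h x y; have := h y x; rewrite csym ler_norml; lra.
exists G, L; split; first exact: ltW.
- apply: (two_sided (fun x y => L * `|x - y|)) => x y; first by rewrite distrC.
  apply: Gcmp => t; exists (y + t - x); rewrite subrKC -[leRHS]addrA lerD2l -mulrDr.
  rewrite ler_pM2l //; have -> : y + t - x = t + (y - x) by ring.
  by rewrite (distrC x) ler_normD.
- apply: (two_sided (fun x y => 1 * `|x - y| `^ al)) => x y; first by rewrite distrC.
  apply: Gcmp => t; exists t; rewrite addrAC lerD2r.
  have := hF (x + t) (y + t); have -> : x + t - (y + t) = x - y by ring.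
  rewrite ler_norml; lra.
- move=> x; have := Gle x 0; rewrite normr0 mulr0 !addr0 => Gx.
  have : F x - e <= G x.
    by apply: lb_le_inf; [exact: (Sinf x).1 | move=> _ [t _ <-]; exact: lb].
  rewrite ler_norml; lra.
Qed.

End Lipschitz.

(** * Triangle waves *)

Section Wave.
Context {R : realType}.
Implicit Types x y l a : R.

(** Distance from [x] to the nearest even integer. *)
Definition triangle x : R :=
  if odd `|Num.floor x| then (Num.floor x + 1)%:~R - x else x - (Num.floor x)%:~R.

Lemma triangle_itv x : 0 <= triangle x <= 1.
Proof.
have := floor_le x; have := floorD1_gt x; rewrite /triangle intrD.
by case: ifP => _; lra.
Qed.

Lemma triangle_dist_le1 x y : `|triangle x - triangle y| <= 1.
Proof.
by have := triangle_itv x; have := triangle_itv y; rewrite ler_norml; lra.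
Qed.

Lemma triangle_same_floor x y : Num.floor x = Num.floor y ->
  `|triangle x - triangle y| = `|x - y|.
Proof.
rewrite /triangle => ->; case: ifP => _; last by congr `|_|; ring.
by rewrite distrC; congr `|_|; ring.
Qed.

Lemma triangle_lipschitz x y : `|triangle x - triangle y| <= `|x - y|.
Proof.
wlog xy : x y / x <= y => [H|].
  by have [xy|/ltW yx] := leP x y; [exact: H|rewrite distrC (distrC x) H].
have := le_floor xy; rewrite le_eqVlt => /predU1P[/triangle_same_floor->//|fxy].
rewrite (distrC x) (ger0_norm (_ : 0 <= y - x)) ?subr_ge0 //.
have := floor_itv x; have := floor_itv y; rewrite !intrD.
have [f2|f2] := leP (Num.floor x + 2) (Num.floor y).
  move=> h1 h2; apply: le_trans (triangle_dist_le1 x y) _.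
  by move: f2; rewrite -(ler_int R) intrD; lra.
have -> : Num.floor y = Num.floor x + 1 by lia.
rewrite /triangle; have -> : Num.floor y = Num.floor x + 1 by lia.
have -> : odd `|Num.floor x + 1| = ~~ odd `|Num.floor x| by lia.
rewrite !intrD ler_norml; case: (odd _) => /=; lra.
Qed.

Definition wave l a x : R := l `^ a * triangle (x / l).

Lemma wave_dist l a x y :
  `|wave l a x - wave l a y| = l `^ a * `|triangle (x / l) - triangle (y / l)|.
Proof. by rewrite /wave -mulrBr normrM (ger0_norm (powR_ge0 _ _)). Qed.

Lemma wave_ge0 l a x : 0 <= wave l a x.
Proof.
by rewrite mulr_ge0 ?powR_ge0 //; case/andP: (triangle_itv (x / l)).
Qed.

Lemma wave_le l a x : wave l a x <= l `^ a.
Proof.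
by rewrite ler_piMr ?powR_ge0 //; case/andP: (triangle_itv (x / l)).
Qed.

Lemma wave_dist_le l a x y : `|wave l a x - wave l a y| <= l `^ a.
Proof. by rewrite wave_dist ler_piMr ?powR_ge0 // triangle_dist_le1. Qed.

Lemma wave_slope l a x y : 0 < l ->
  l `^ a * `|x / l - y / l| = l `^ (a - 1) * `|x - y|.
Proof.
move=> l0; rewrite -mulrBl normrM (gtr0_norm (_ : 0 < l^-1)) ?invr_gt0 //.
by rewrite powRB ?(gt_eqF l0) ?implybT // powRr1 ?(ltW l0) // mulrAC mulrA.
Qed.

Lemma wave_same_cell l a x y : 0 < l -> cell l x = cell l y ->
  `|wave l a x - wave l a y| = l `^ (a - 1) * `|x - y|.
Proof. by move=> l0 e; rewrite wave_dist triangle_same_floor // wave_slope. Qed.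

Lemma wave_lipschitz l a : 0 < l -> lipschitz (wave l a) (l `^ (a - 1)).
Proof.
move=> l0 x y; rewrite -wave_slope // wave_dist.
by rewrite ler_wpM2l ?powR_ge0 // triangle_lipschitz.
Qed.

(** For [u = |x - y| / l] the increment of the triangle is at most
    [minr 1 u <= u `^ al]. *)
Lemma wave_holder l a (al : R) : 0 < l -> 0 < al -> al <= 1 ->
  holder (wave l a) (l `^ (a - al)) al.
Proof.
move=> l0 al0 al1 x y; have lne : l != 0 by rewrite gt_eqF.
set u := `|x / l - y / l|.
have xyE : `|x - y| = l * u.
  by rewrite /u -mulrBl normrM (gtr0_norm (_ : 0 < l^-1)) ?invr_gt0 // mulrC divfK.
rewrite xyE powRM ?(ltW l0) ?normr_ge0 // mulrA -powRD ?lne ?implybT // subrK.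
rewrite wave_dist ler_wpM2l ?powR_ge0 //.
have [u1|u1] := leP u 1; last first.
  apply: le_trans (triangle_dist_le1 _ _) _.
  by rewrite -[leLHS](powRr0 u) ler_powR // ltW.
have [u0|u0] := eqVneq u 0.
  apply: le_trans (triangle_lipschitz _ _) _.
  by rewrite -/u u0 powR_ge0.
apply: le_trans (triangle_lipschitz _ _) _; rewrite -/u ger1_powR // u1 andbT.
by rewrite lt_neqAle eq_sym u0 normr_ge0.
Qed.

End Wave.

(** * Approximation by functions steep at many scales *)

Section Construction.
Context {R : realType}.
Implicit Types F G H : R -> R.

Lemma holder_sum (al : R) m (c : 'I_m -> R) (W : 'I_m -> R -> R) :
  (forall i, holder (W i) (c i) al) ->
  holder (fun x => \sum_i W i x) (\sum_i c i) al.
Proof.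
move=> hW x y; rewrite -sumrB mulr_suml; apply: le_trans (ler_norm_sum _ _ _) _.
by apply: ler_sum => i _; exact: hW.
Qed.

(** Seen from the scale [l], a wave at a finer scale [l'] is negligible because
    of its small height. *)
Lemma wave_gap_fine (al v a c l l' : R) : 0 < a -> 0 < l -> 0 < l' ->
  l' <= l `^ (1 + v / al) -> l `^ (v / al * a - v) <= c ->
  forall x y, l `^ (1 + v) <= `|x - y| ->
  `|wave l' a x - wave l' a y| <= c * (l `^ (a - 1) * `|x - y|).
Proof.
move=> a0 l0 l'0 l'l lc x y dt.
have c0 : 0 <= c by apply: le_trans lc; exact: powR_ge0.
apply: le_trans (wave_dist_le _ _ _ _) _.
apply: (@le_trans _ _ ((l `^ (1 + v / al)) `^ a)).
  by apply: ge0_ler_powR; rewrite ?nnegrE ?powR_ge0 ?(ltW a0) ?(ltW l'0).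
apply: (@le_trans _ _ (c * (l `^ (a - 1) * l `^ (1 + v)))); last first.
  by apply: ler_wpM2l => //; apply: ler_wpM2l => //; exact: powR_ge0.
rewrite -powRrM -powRD ?(gt_eqF l0) ?implybT //.
have -> : (1 + v / al) * a = (v / al * a - v) + (a - 1 + (1 + v)) by ring.
rewrite [leLHS]powRD ?(gt_eqF l0) ?implybT //.
by apply: ler_wpM2r => //; exact: powR_ge0.
Qed.

(** Seen from the scale [l'], a wave at a coarser scale [l] is negligible because
    of its small slope. *)
Lemma wave_gap_coarse (al v a c l l' : R) : a < 1 -> 0 < l -> 0 < l' ->
  l' <= l `^ (1 + v / al) -> l `^ (v / al * (1 - a)) <= c ->
  forall x y, `|wave l a x - wave l a y| <= c * (l' `^ (a - 1) * `|x - y|).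
Proof.
move=> a1 l0 l'0 l'l lc x y.
apply: le_trans (wave_lipschitz a l0 x y) _.
rewrite mulrA; apply: ler_wpM2r; first exact: normr_ge0.
have -> : a - 1 = - (1 - a) by ring.
rewrite !powRN ler_pdivlMr ?powR_gt0 // mulrC ler_pdivrMr ?powR_gt0 //.
apply: (@le_trans _ _ ((l `^ (1 + v / al)) `^ (1 - a))).
  by apply: ge0_ler_powR; rewrite ?nnegrE ?subr_ge0 ?powR_ge0 ?(ltW a1) ?(ltW l'0).
rewrite -powRrM.
have -> : (1 + v / al) * (1 - a) = v / al * (1 - a) + (1 - a) by ring.
rewrite powRD ?(gt_eqF l0) ?implybT //.
by apply: ler_wpM2r => //; exact: powR_ge0.
Qed.

Lemma scale_gap (al v a q c : R) i j : 0 < al -> 0 < v -> al < a -> a < 1 ->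
  0 < q -> q < 1 ->
  q `^ (v / al * (1 - a)) <= c -> q `^ (v / al * a - v) <= c ->
  i != j -> forall x y, scale al v q i `^ (1 + v) <= `|x - y| ->
  `|wave (scale al v q j) a x - wave (scale al v q j) a y| <=
  c * (scale al v q i `^ (a - 1) * `|x - y|).
Proof.
move=> al0 v0 ala a1 q0 q1 c1 c2 ij x y dt.
have a0 : 0 < a by apply: lt_trans ala.
have va : 0 < v / al by rewrite divr_gt0.
have small k r : 0 <= r -> q `^ r <= c -> scale al v q k `^ r <= c.
  by move=> r0; apply: le_trans; exact: scale_powR_le.
have next k n : (k < n)%N -> scale al v q n <= scale al v q k `^ (1 + v / al).
  by move=> kn; rewrite -scaleS; exact: scale_homo.
case: (ltngtP i j) ij => // [ij|ji] _.
  apply: (@wave_gap_fine al v) (next _ _ ij) _ _ _ dt => //; try exact: scale_gt0.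
  apply: small => //; rewrite subr_ge0 mulrAC ler_pdivlMr //.
  by apply: ler_wpM2l; exact: ltW.
apply: (@wave_gap_coarse al v) (next _ _ ji) _ _ _ => //; try exact: scale_gt0.
by apply: small => //; rewrite mulr_ge0 ?subr_ge0 // ltW.
Qed.

(** On a cell of the scale [l] the wave of that scale is affine with slope
    [l `^ (a - 1)]; the Lipschitz part costs at most a quarter of its increment
    and all other waves together at most an eighth. *)
Lemma steep_lipschitz_waves p (L tau al v a q : R) m (i : 'I_m.+1) :
  0 < al -> 0 < v -> al < a -> a < 1 -> 0 < q -> q < 1 ->
  0 <= tau -> tau <= 1 -> 0 <= L -> lipschitz p L ->
  L * q `^ (1 - a) <= 4^-1 ->
  m.+1%:R * q `^ (v / al * (1 - a)) <= 8^-1 ->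
  m.+1%:R * q `^ (v / al * a - v) <= 8^-1 ->
  let G x := (1 - tau) * p x + \sum_(j < m.+1) wave (scale al v q j) a x in
  let l := scale al v q i in
  forall x y, cell l x = cell l y -> l `^ (1 + v) <= `|x - y| ->
  5 / 8 * (l `^ (a - 1) * `|x - y|) <= `|G x - G y|.
Proof.
have split_bound (X Y Z W : R) : `|Y| <= X / 4 -> `|W| <= X / 8 -> `|Z| = X ->
    5 / 8 * X <= `|Y + (Z + W)|.
  move=> Y4 W8 ZX; have := lerB_normD Z (Y + W).
  have := ler_normD Y W; rewrite (_ : Z + (Y + W) = Y + (Z + W)); last by ring.
  lra.
move=> al0 v0 ala a1 q0 q1 t0 t1 L0 pL qL qc1 qc2 G l x y xy dt.
have l0 : 0 < l by exact: scale_gt0.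
set X := l `^ (a - 1) * `|x - y|.
have -> : G x - G y = (1 - tau) * (p x - p y) +
    ((wave l a x - wave l a y) + \sum_(j < m.+1 | j != i)
      (wave (scale al v q j) a x - wave (scale al v q j) a y)).
  rewrite -(bigD1 i (P := xpredT)
    (F := fun j : 'I_m.+1 => wave (scale al v q j) a x - wave (scale al v q j) a y)) //.
  by rewrite sumrB /G; ring.
apply: split_bound.
- rewrite normrM; apply: (@le_trans _ _ (1 * (L * `|x - y|))).
    apply: ler_pM; [exact: normr_ge0|exact: normr_ge0| |exact: pL].
    by rewrite ger0_norm ?subr_ge0 // lerBlDr lerDl.
  rewrite mul1r /X mulrAC; apply: ler_wpM2r; first exact: normr_ge0.
  have -> : a - 1 = - (1 - a) by ring.
  rewrite powRN mulrC ler_pdivlMr ?powR_gt0 //.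
  apply: le_trans qL; apply: ler_wpM2l => //.
  apply: ge0_ler_powR; rewrite ?nnegrE ?subr_ge0 ?(ltW a1) ?(ltW q0) ?(ltW l0) //.
  exact: scale_le.
- pose c : R := (8 * m.+1%:R)^-1.
  have m0 : 0 < m.+1%:R :> R by rewrite ltr0n.
  have cm : c * m.+1%:R = 8^-1 by rewrite /c invfM divfK // gt_eqF.
  have toc (z : R) : m.+1%:R * z <= 8^-1 -> z <= c.
    by rewrite -cm (mulrC c) ler_pM2l.
  have c0 : 0 <= c by rewrite invr_ge0 mulr_ge0 // ltW.
  have X0 : 0 <= X by rewrite mulr_ge0 ?powR_ge0.
  apply: le_trans (ler_norm_sum _ _ _) _.
  apply: (@le_trans _ _ (\sum_(j < m.+1) c * X)); last first.
    by rewrite sumr_const card_ord -(mulr_natr (c * X)) mulrAC cm (mulrC X).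
  rewrite big_mkcond /=; apply: ler_sum => j _; case: ifPn => [ji|_]; last first.
    exact: mulr_ge0.
  have ij : (i : nat) != j by rewrite eq_sym.
  exact: (scale_gap al0 v0 ala a1 q0 q1 (toc _ qc1) (toc _ qc2) ij dt).
- exact: wave_same_cell.
Qed.

(** Shrink a Lipschitz approximation [p] of [F] by the factor [1 - tau] and add
    the waves of the scales [0] to [m]. For [q] small the waves are so low that
    their sum has Hoelder constant at most [tau], as [al < a], and so steep that
    they dominate [p] at the relevant scales. *)
Lemma exists_steep F (al v a r Q : R) m : 0 < al -> 0 < v -> al < a -> a < 1 ->
  0 < r -> 0 < Q -> holder F 1 al ->
  exists G (q e : R), [/\ holder G 1 al,
    forall x, `[0, 1]%classic x -> `|F x - G x| <= r, 0 < q < Q, 0 < e &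
    forall H, (forall x, `[0, 1]%classic x -> `|G x - H x| <= e) ->
      forall i, (i <= m)%N -> steep `[0, 1] H (scale al v q i)
        (scale al v q i `^ (1 + v)) (scale al v q i `^ (a - 1) / 4)].
Proof.
move=> al0 v0 ala a1 r0 Q0 hF.
have al1 : al < 1 by apply: lt_trans a1.
have a0 : 0 < a by apply: lt_trans ala.
have r4 : 0 < r / 4 by rewrite divr_gt0.
have [p [L [L0 pL pH pF]]] := lipschitz_approx al0 al1 r4 hF.
have [M M1 FM] : exists2 M : R, 1 <= M & forall x, `[0, 1]%classic x -> `|F x| <= M.
  exists (`|F 0| + 1); first by rewrite lerDr.
  move=> x /=; rewrite in_itv /= => /andP[x0 x1].
  have : `|F x - F 0| <= 1.
    apply: le_trans (hF x 0) _; rewrite mul1r subr0 ger0_norm //.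
    have := ge0_ler_powR (ltW al0) (x := x) (y := 1).
    by rewrite powR1; apply; rewrite ?nnegrE.
  move=> h; rewrite -[F x](subrK (F 0)); apply: le_trans (ler_normD _ _) _.
  by rewrite addrC lerD2l.
have Mr : 0 < M + r by rewrite addr_gt0 // (lt_le_trans ltr01).
have [tau [tau0 tau1 tauM]] : exists tau : R,
    [/\ 0 < tau, tau <= 1 & tau * (M + r) = r / 4].
  exists (r / 4 / (M + r)); split; first by rewrite divr_gt0.
    by rewrite ler_pdivrMr // mul1r; lra.
  by rewrite divfK // gt_eqF.
have m0 : 0 < m.+1%:R :> R by rewrite ltr0n.
have pow_near (c b e : R) : 0 < c -> 0 < b -> 0 < e ->
    \forall q \near 0^'+, c * q `^ b < e.
  move=> c0 b0 e0; near=> q; rewrite mulrC -ltr_pdivlMr //.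
  by near: q; apply: near0_powR_lt => //; rewrite divr_gt0.
have [q [[q0 qQ q1] [qtau qr] [qL qc1 qc2]]] : exists q : R,
    [/\ [/\ 0 < q, q < Q & q < 1],
    m.+1%:R * q `^ (a - al) < tau /\ m.+1%:R * q `^ a < r / 4 &
    [/\ (L + 1) * q `^ (1 - a) < 4^-1, m.+1%:R * q `^ (v / al * (1 - a)) < 8^-1 &
    m.+1%:R * q `^ (v / al * a - v) < 8^-1]].
  near (0 : R)^'+ => q; exists q; split; first split.
  - by near: q; exact: nbhs_right_gt.
  - by near: q; exact: nbhs_right_lt.
  - by near: q; exact: nbhs_right_lt.
  - split; near: q; apply: pow_near => //; by rewrite subr_gt0.
  - split; near: q; apply: pow_near => //.
    + exact: ltr_wpDl.
    + by rewrite subr_gt0.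
    + by rewrite mulr_gt0 ?divr_gt0 ?subr_gt0.
    + rewrite subr_gt0 mulrAC ltr_pdivlMr //.
      by rewrite ltr_pM2l.
pose W x := \sum_(j < m.+1) wave (scale al v q j) a x.
have small j (b : R) : 0 <= b -> scale al v q j `^ b <= q `^ b.
  exact: scale_powR_le.
have sum_const (c : R) : \sum_(j < m.+1) c = m.+1%:R * c.
  by rewrite sumr_const card_ord mulr_natl.
have W0 x : 0 <= W x by apply: sumr_ge0 => j _; exact: wave_ge0.
have W4 x : W x <= r / 4.
  apply: le_trans (ltW qr); rewrite -sum_const; apply: ler_sum => j _.
  by apply: le_trans (wave_le _ _ _) _; apply: small; exact: ltW.
have WH : holder W tau al.
  move=> x y.
  apply: le_trans (holder_sum
    (fun j : 'I_m.+1 => wave_holder a (scale_gt0 al v j q0) al0 (ltW al1)) x y) _.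
  apply: ler_wpM2r; first exact: powR_ge0.
  apply: le_trans (ltW qtau); rewrite -sum_const; apply: ler_sum => j _.
  by apply: small; rewrite subr_ge0 ltW.
have steepW (i : 'I_m.+1) := @steep_lipschitz_waves p L tau al v a q m i
  al0 v0 ala a1 q0 q1 (ltW tau0) tau1 L0 pL.
pose G x := (1 - tau) * p x + W x.
(* An eighth of the increment of the finest wave over the shortest distance that
   its steepness condition concerns. *)
pose e := scale al v q m `^ (a + v) / 8.
have e0 : 0 < e by rewrite divr_gt0 // powR_gt0 // scale_gt0.
exists G, q, e; split => //.
- move=> x y; rewrite /G mul1r.
  have -> : (1 - tau) * p x + W x - ((1 - tau) * p y + W y) =
    (1 - tau) * (p x - p y) + (W x - W y) by ring.
  apply: le_trans (ler_normD _ _) _.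
  have -> : `|x - y| `^ al = (1 - tau) * `|x - y| `^ al + tau * `|x - y| `^ al.
    by ring.
  apply: lerD; last exact: WH.
  rewrite normrM ger0_norm ?subr_ge0 //; apply: ler_wpM2l; first by rewrite subr_ge0.
  by have := pH x y; rewrite mul1r.
- move=> x x01; have := pF x; have := FM x x01; have := W0 x; have := W4 x.
  rewrite /G => w4 w0 fM pf.
  have pM : `|p x| <= M + r.
    have -> : p x = F x - (F x - p x) by ring.
    by apply: le_trans (ler_normB _ _) _; apply: lerD => //; apply: le_trans pf _; lra.
  have tp : `|tau * p x| <= r / 4.
    by rewrite normrM gtr0_norm // -tauM; apply: ler_wpM2l => //; exact: ltW.
  have -> : F x - ((1 - tau) * p x + W x) = (F x - p x) + tau * p x - W x by ring.
  move: pf tp w4 w0; clear; move: (F x - p x) (tau * p x) (W x) => X Y Z.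
  rewrite !ler_norml; lra.
- by rewrite q0 qQ.
move=> H GH i im x y x01 y01 xy dt.
have := steepW (Ordinal (im : (i < m.+1)%N)).
move=> /(_ _ _ _ x y xy dt) /=; rewrite -/(W x) -/(W y) -/(G x) -/(G y).
have eK : e <= (scale al v q i `^ (a - 1) * `|x - y|) / 8.
  apply: ler_wpM2r => //.
  apply: (@le_trans _ _ (scale al v q i `^ (a + v))).
    apply: ge0_ler_powR; rewrite ?nnegrE ?(ltW (scale_gt0 _ _ _ _)) //.
      by rewrite addr_ge0 // ltW.
    exact: scale_homo.
  have -> : a + v = (a - 1) + (1 + v) by ring.
  rewrite powRD ?(gt_eqF (scale_gt0 _ _ _ _)) ?implybT //.
  by apply: ler_wpM2l => //; exact: powR_ge0.
have fin (X gx gy hx hy : R) : e <= X / 8 -> 5 / 8 * X <= `|gx - gy| ->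
    `|gx - hx| <= e -> `|gy - hy| <= e -> X / 4 <= `|hx - hy|.
  move=> eX gX hx' hy'.
  have -> : hx - hy = (gx - gy) - ((gx - hx) - (gy - hy)) by ring.
  have := lerB_dist (gx - gy) ((gx - hx) - (gy - hy)).
  by have := ler_normB (gx - hx) (gy - hy); lra.
move=> h; rewrite mulrAC; apply: (fin _ _ _ _ _ eK _ (GH x x01) (GH y y01)); apply: h.
- apply: le_trans (ltW qL); apply: ler_wpM2r; first exact: powR_ge0.
  by rewrite lerDl.
- exact: ltW.
- exact: ltW.
Unshelve. all: by end_near. Qed.

End Construction.

(** * Choice of the exponents *)

Section Exponents.
Context {R : realType}.
Implicit Types al b s : R.

Lemma rat_between (x y : R) : x < y -> exists q : rat, x < ratr q /\ ratr q < y.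
Proof. by move=> /rat_in_itvoo[q]; rewrite in_itv /= => /andP[]; exists q. Qed.

(** In both applications [v] has to exceed [(1 - al) / s - 1], so that covers
    contract, and to satisfy one linear upper bound. *)
Lemma pick_slope al s (K T : R) : 0 < s -> 0 < T ->
  (0 < K -> (1 - al) / s - 1 < T / K) ->
  exists v : rat, [/\ 0 < ratr v :> R, 1 - al < s * (1 + ratr v) &
    ratr v * K < T].
Proof.
move=> s0 T0 hK; pose lo := Num.max 0 ((1 - al) / s - 1).
have [v [lov vK]] : exists v : rat, lo < ratr v /\ ratr v * K < T.
  have [K0|K0] := leP K 0.
    have [v [lov _]] : exists v : rat, lo < ratr v /\ ratr v < lo + 1.
      by apply: rat_between; rewrite ltrDl ltr01.
    exists v; split=> //; apply: le_lt_trans T0; rewrite mulr_ge0_le0 //.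
    by apply: le_trans (ltW lov); rewrite /lo le_max lexx.
  have [v [lov vT]] : exists v : rat, lo < ratr v /\ ratr v < T / K.
    by apply: rat_between; rewrite /lo gt_max divr_gt0 //= hK.
  by exists v; rewrite lov -ltr_pdivlMr.
move: lov; rewrite gt_max => /andP[v0 vs]; exists v; split=> //.
by move: vs; rewrite ltrBlDr ltr_pdivrMr // mulrC (addrC _ 1).
Qed.

(** For [a = al] and [b < 1] the last inequality is [v < (b - al) / (1 - b)]; at that
    bound [(1 - al) / (1 + v)] equals [1 - b]. *)
Lemma holder_parameters al b s : 0 < al -> al < b -> b <= 1 -> 1 - b < s ->
  exists v a : rat, [/\ 0 < ratr v :> R, al < ratr a, ratr a < 1 :> R,
    1 - al < s * (1 + ratr v) & ratr v + ratr a < b * (1 + ratr v)].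
Proof.
move=> al0 alb b1 bs; have s0 : 0 < s by lra.
have al1 : 0 < 1 - al by lra.
have [|||v [v0 sv vb]] := @pick_slope al s (1 - b) (b - al) => //.
- by rewrite subr_gt0.
- move=> b1'; have -> : (b - al) / (1 - b) = (1 - al) / (1 - b) - 1.
    by field; rewrite gt_eqF.
  by rewrite ltrD2r ltr_pM2l // ltf_pV2.
have [a [loa upa]] : exists a : rat, al < ratr a /\ ratr a < b - ratr v * (1 - b).
  by apply: rat_between; lra.
have vb0 : 0 <= ratr v * (1 - b) by rewrite mulr_ge0 ?subr_ge0 // ltW.
by exists v, a; split => //; lra.
Qed.

(** For [a = al] the last two inequalities bound [s] below by
    [(1 - al) / (1 + v)], decreasing in [v], and by
    [b * (al + v) / (1 + v)], increasing in [v]. They agree, with the value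
    [b / (b + 1)], at a positive [v] if [al * b < 1 - al]; otherwise the best
    choice is [v] close to [0], with limit [al * b]. *)
Lemma variation_parameters al b s : 0 < al -> al < 1 -> 0 < b ->
  al * b < s -> b / (b + 1) < s ->
  exists v a : rat, [/\ 0 < ratr v :> R, al < ratr a, ratr a < 1 :> R,
    1 - al < s * (1 + ratr v) & b * (ratr v + ratr a) < s * (1 + ratr v)].
Proof.
move=> al0 al1 b0 abs; have b10 : 0 < b + 1 by lra.
rewrite ltr_pdivrMr // => bs.
have s0 : 0 < s by apply: lt_trans abs; rewrite mulr_gt0.
have [|||v [v0 sv vb]] := @pick_slope al s (b - s) (s - al * b) => //.
- by rewrite subr_gt0.
- move=> bs0; have -> : (s - al * b) / (b - s) = (1 - al) * (b / (b - s)) - 1.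
    by field; rewrite gt_eqF.
  rewrite ltrD2r ltr_pM2l ?subr_gt0 // ltr_pdivlMr // mulrC ltr_pdivrMr //.
  by lra.
have [a [loa]] : exists a : rat, al < ratr a /\
    ratr a < Num.min 1 ((s * (1 + ratr v) - b * ratr v) / b).
  by apply: rat_between; rewrite lt_min al1 /= ltr_pdivlMr //; lra.
rewrite lt_min ltr_pdivlMr // => /andP[a1 upa].
by exists v, a; split => //; lra.
Qed.

End Exponents.

(** * Meager sets *)

Section Category.

Lemma nowhere_denseS (T : topologicalType) (A B : set T) : A `<=` B ->
  nowhere_dense B -> nowhere_dense A.
Proof.
rewrite /nowhere_dense -!classical_sets.subset0 => AB; apply: subset_trans.
by apply: interiorS; exact: closureS.
Qed.

Lemma comeager_bigcap (T : topologicalType) (I : countType) (P : I -> set T)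
    (S : set T) :
  (forall i, nowhere_dense (~` P i)) -> \bigcap_i P i `<=` S -> comeager S.
Proof.
move=> nd PS; pose F n : set T :=
  (if unpickle n is Some i then ~` P i else set0) `&` ~` S.
exists F; split => [n|].
  rewrite /F; case: unpickle => [i|]; first exact: nowhere_denseS (nd i).
  rewrite set0I /nowhere_dense closure0.
  by apply/seteqP; split=> // x /interior_subset.
apply/seteqP; split=> [f nSf|f [n _ []]//].
have [i nPi] : exists i, ~ P i f.
  by apply/existsNP => h; apply: nSf; apply: PS => i _; exact: h.
by exists (pickle i) => //; rewrite /F pickleK.
Qed.

End Category.

(** * Multiscale steepness is generic *)

Section Genericity.
Context {R : realType} {al : R} {al0 : 0 < al}.
Local Notation C := (holder1 al0).

Definition clamp (x : R) : R := Num.max 0 (Num.min 1 x).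

Lemma clamp_itv x : clamp x \in (`[0, 1]%classic : set R).
Proof.
by apply/mem_set; rewrite /= in_itv /= /clamp le_max lexx ge_max ler01 ge_min lexx.
Qed.

Lemma clamp_dist x y : `|clamp x - clamp y| <= `|x - y|.
Proof.
rewrite /clamp /Num.max /Num.min.
by repeat case: ifP; rewrite ?ler_norml; case: (lerP y x) => xy; lra.
Qed.

(** Constant on both sides of [[0, 1]]; this keeps the modulus of continuity and
    avoids subtypes in the analysis. *)
Definition extend (f : C) (x : R) : R := f (exist _ (clamp x) (clamp_itv x)).

Lemma extend_val (f : C) x : extend f (val x) = f x.
Proof.
rewrite /extend; congr (holder1_fun f _); apply: val_inj => /=.
case: x => x /= /set_mem /=; rewrite in_itv /= => /andP[x0 x1].
by rewrite /clamp (min_idPr x1) (max_idPr x0).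
Qed.

Lemma extend_holder (f : C) : holder (extend f) 1 al.
Proof.
move=> x y; rewrite mul1r; apply: le_trans (holder1P f _ _) _ => /=.
apply: ge0_ler_powR; rewrite ?nnegrE //; first exact: ltW.
exact: clamp_dist.
Qed.

Lemma extend_surj (G : R -> R) : holder G 1 al ->
  exists f : C, forall x, `[0, 1]%classic x -> extend f x = G x.
Proof.
move=> hG.
pose S := [set f : `[0%R, 1%R]%classic -> R |
  forall x y, `|f x - f y| <= `|val x - val y| `^ al].
have GP : (fun x : `[0%R, 1%R]%classic => G (val x)) \in S.
  by apply/mem_set => x y /=; have := hG (val x) (val y); rewrite mul1r.
exists (exist (fun f => f \in S) _ GP) => x x01.
by rewrite (_ : x = val (exist _ x (mem_set x01) : `[0%R, 1%R]%classic)) // extend_val.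
Qed.

Lemma ball_holder1 (f g : C) (r : R) : ball f r g = (max_dist f g < r).
Proof. by rewrite ballEmdist. Qed.

Lemma max_dist_extend_le (f g : C) (r : R) :
  (forall x, `[0, 1]%classic x -> `|extend f x - extend g x| <= r) ->
  max_dist f g <= r.
Proof.
move=> h; apply: max_dist_le => x; rewrite -!extend_val; apply: h.
by case: x => x /= /set_mem.
Qed.

Lemma extend_le_max_dist (f g : C) x :
  `|extend f x - extend g x| <= max_dist f g.
Proof. exact: le_max_dist. Qed.

Definition multi_steep (v a : R) (m : nat) : set C := [set f | exists q : R,
  0 < q < m.+1%:R^-1 /\ forall i, (i <= m)%N ->
    steep `[0, 1] (extend f) (scale al v q i)
      (scale al v q i `^ (1 + v)) (scale al v q i `^ (a - 1) / 4)].

(** Near any [f] there is a steep [g], and a small ball around [g] consists of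
    functions that are still steep. *)
Lemma multi_steep_nowhere_dense (v a : R) m : 0 < v -> al < a -> a < 1 ->
  nowhere_dense (~` multi_steep v a m).
Proof.
move=> v0 ala a1; rewrite /nowhere_dense -classical_sets.subset0 => f.
rewrite /interior => /nbhs_ballP[r /= r0 fr].
have Q0 : 0 < m.+1%:R^-1 :> R by rewrite invr_gt0 ltr0n.
have r2 : 0 < r / 2 by rewrite divr_gt0.
have [G [q [e [hG fG q01 e0 good]]]] :=
  exists_steep m al0 v0 ala a1 r2 Q0 (extend_holder f).
have [g gG] := extend_surj hG.
have /fr : ball f r g.
  rewrite ball_holder1; apply: (@le_lt_trans _ _ (r / 2)); last by lra.
  by apply: max_dist_extend_le => x x01; rewrite gG // fG.
move=> /(_ (ball g e)) []; first by apply/nbhs_ballP; exists e.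
move=> h [nh]; rewrite ball_holder1 => gh; apply: nh; exists q; split => //.
move=> i im; apply: good => // x x01; rewrite -gG //.
by apply: le_trans (extend_le_max_dist g h x) _; exact: ltW.
Qed.

Lemma multi_steepP (v a : R) (f : C) : (forall m, multi_steep v a m f) ->
  forall (n : nat) (Q : R), 0 < Q -> exists q, [/\ 0 < q, q < Q &
    forall i, (i <= n)%N -> steep `[0, 1] (extend f) (scale al v q i)
      (scale al v q i `^ (1 + v)) (scale al v q i `^ (a - 1) / 4)].
Proof.
move=> hf n Q Q0; pose m := maxn n (Num.truncn Q^-1).
have [q [/andP[q0 qm] st]] := hf m; exists q; split => //.
  apply: (lt_le_trans qm); rewrite -[leRHS]invrK lef_pV2 ?posrE ?invr_gt0 ?ltr0n //.
  apply: (@le_trans _ _ (Num.truncn Q^-1).+1%:R); first exact/ltW/truncnS_gt.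
  by rewrite ler_nat ltnS leq_maxr.
by move=> i ii; apply: st; apply: leq_trans ii _; exact: leq_maxl.
Qed.

End Genericity.

(** * Restrictions of functions that are steep at many scales *)

Section Restriction.
Context {R : realType} {al : R} {al0 : 0 < al}.
Implicit Types (f : holder1 al0) (A : set R).

Lemma extend_incl f A (A01 : A `<=` `[0, 1]%classic) (x : A) :
  (f \o set_incl A01) x = extend f (val x).
Proof. by rewrite -[val x]/(val (set_incl A01 x)) extend_val. Qed.

Lemma holder_on_extend f A (A01 : A `<=` `[0, 1]%classic) (b : R) :
  holder_on b (f \o set_incl A01) ->
  exists2 c, 0 < c & forall x y, A x -> A y ->
    `|extend f x - extend f y| <= c * `|x - y| `^ b.
Proof.
move=> [c [c0 hc]]; exists c => // x y Ax Ay.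
by have := hc (exist _ x (mem_set Ax)) (exist _ y (mem_set Ay)); rewrite !extend_incl.
Qed.

Lemma power_variation_extend f A (A01 : A `<=` `[0, 1]%classic) (b : R) :
  (power_variation b (f \o set_incl A01) < +oo)%E ->
  exists2 M, 0 <= M & forall xs, sorted <%R xs -> {in xs, forall x, A x} ->
    \sum_(1 <= i < size xs) `|extend f xs`_i - extend f xs`_i.-1| `^ b <= M.
Proof.
set V := power_variation _ _ => Voo.
exists (Num.max 0 (fine V)); first by rewrite le_max lexx.
move=> xs sxs xsA; have [sz1|sz1] := leqP (size xs) 1.
  by rewrite big_geq // le_max lexx.
have [x0 [ys xsE]] : exists x0 ys, xs = x0 :: ys.
  by case: xs sz1 {sxs xsA} => // x0 ys; exists x0, ys.
have Anth i : A (nth x0 xs i).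
  have [isz|isz] := ltnP i (size xs); first by apply: xsA; exact: mem_nth.
  by rewrite nth_default //; apply: xsA; rewrite xsE mem_head.
pose x i : A := exist _ (nth x0 xs i) (mem_set (Anth i)).
have : ((\sum_(1 <= i < (size xs).-1.+1)
    `|(f \o set_incl A01) (x i) - (f \o set_incl A01) (x i.-1)| `^ b)%:E <= V)%E.
  apply: ereal_sup_ubound; exists (size xs).-1, x; split => //.
    by rewrite -ltnS (ltn_predK sz1).
  move=> i isz /=; apply: (sorted_ltn_nth lt_trans) sxs _ _ _ _ _ => //.
  - by rewrite inE; apply: leq_trans isz _; exact: leq_pred.
  - by rewrite inE -(ltn_predK sz1) ltnS.
rewrite (ltn_predK sz1) => SV.
have : fine V >= \sum_(1 <= i < size xs)
    `|(f \o set_incl A01) (x i) - (f \o set_incl A01) (x i.-1)| `^ b.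
  by case: V Voo SV => [V| |] //= _; rewrite lee_fin.
move=> h; rewrite le_max; apply/orP; right; apply: le_trans h.
rewrite !big_nat; apply: ler_sum => i /andP[i0 isz].
rewrite !extend_incl /= !(set_nth_default x0 0) //.
by apply: leq_ltn_trans isz; exact: leq_pred.
Qed.

(** The condition [v + a < b * (1 + v)] makes the rise [l `^ (a + v)] of a wave
    over the distance [l `^ (1 + v)] exceed, for small [l], any multiple of the
    [b]-th power of that distance. *)
Lemma holder_restriction_null f A (A01 : A `<=` `[0, 1]%classic) (v a b s : R) :
  al < 1 -> 0 < v -> a < 1 -> b <= 1 -> 0 < s ->
  1 - al < s * (1 + v) -> v + a < b * (1 + v) ->
  (forall m, multi_steep v a m f) ->
  holder_on b (f \o set_incl A01) -> hausdorff_measure s A = 0%E.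
Proof.
move=> al1 v0 a1 b1 s0 sv vab st /holder_on_extend[c c0 hc].
pose r := b * (1 + v) - (v + a).
have r0 : 0 < r by rewrite subr_gt0.
have sv0 : 0 < s * (1 + v) by rewrite mulr_gt0 // ltr_wpDr // ltW.
have [Q0 Q0_gt0 hQ0] : exists2 Q : R, 0 < Q &
    forall q, 0 < q -> q < Q -> q `^ r < (4 * c)^-1.
  by apply: near0_ex; apply: near0_powR_lt => //; rewrite invr_gt0 mulr_gt0.
apply: (hausdorff_measure_eq0_stays al0 al1 v0 s0 (lexx 0) A01 sv sv0).
move=> n Q Qgt0.
have Qm : 0 < Num.min Q0 (Num.min Q 1) by rewrite !lt_min Q0_gt0 Qgt0 ltr01.
have [q [q0 qm hq]] := multi_steepP st n Qm.
move: qm; rewrite !lt_min => /and3P[qQ0 qQ q1].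
exists q; split => // i ii; rewrite mul0r.
have l0 : 0 < scale al v q i by exact: scale_gt0.
apply: (@few_stays_holder _ A (extend f) _ _ (scale al v q i `^ (a - 1) / 4) b c).
- exact: powR_gt0.
- by rewrite divr_ge0 ?powR_ge0.
- exact: b1.
- rewrite -powRrM mulrAC ltr_pdivlMr // mulrC -powRD ?(gt_eqF l0) ?implybT //.
  have -> : a - 1 + (1 + v) * (1 - b) = - r by rewrite /r; ring.
  rewrite powRN -[ltLHS]invrK ltf_pV2 ?posrE ?invr_gt0 ?powR_gt0 ?mulr_gt0 //.
  apply: le_lt_trans (hQ0 q q0 qQ0).
  by apply: scale_powR_le => //; exact: ltW.
- exact: steepS A01 (hq i ii).
- exact: hc.
Qed.

(** A variation [M] allows about [M * l `^ (- b * (a + v))] stays; the condition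
    [b * (v + a) < s * (1 + v)] makes intervals of length [l `^ (1 + v)] in that
    number negligible for the [s]-dimensional measure. *)
Lemma variation_restriction_null f A (A01 : A `<=` `[0, 1]%classic) (v a b s : R) :
  al < 1 -> 0 < v -> 0 < b -> 0 < s ->
  1 - al < s * (1 + v) -> b * (v + a) < s * (1 + v) ->
  (forall m, multi_steep v a m f) ->
  (power_variation b (f \o set_incl A01) < +oo)%E -> hausdorff_measure s A = 0%E.
Proof.
move=> al1 v0 b0 s0 sv bva st /power_variation_extend[M M0 hM].
have C0 : 0 <= M * 4 `^ b by rewrite mulr_ge0 ?powR_ge0.
apply: (hausdorff_measure_eq0_stays al0 al1 v0 s0 C0 A01 sv bva).
move=> n Q Qgt0; have [q [q0 qQ hq]] := multi_steepP st n Qgt0.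
exists q; split => // i ii.
have l0 : 0 < scale al v q i by exact: scale_gt0.
have := few_stays_variation _ _ b0 (steepS A01 (hq i ii)) hM.
move=> /(_ (powR_gt0 _ l0) (divr_gt0 (powR_gt0 _ l0) (ltr0Sn _ 3))).
rewrite mulrAC -powRD ?(gt_eqF l0) ?implybT //.
have -> : a - 1 + (1 + v) = v + a by ring.
rewrite powRM ?powR_ge0 ?invr_ge0 // -powRrM (mulrC (v + a)) mulNr.
have -> : 4^-1 `^ (- b) = 4 `^ b :> R by rewrite -powR_inv1 // -powRrM mulN1r opprK.
by rewrite (mulrC (scale _ _ _ _ `^ _)) mulrA.
Qed.

End Restriction.

(** * The generic restriction theorem *)

Theorem theorem2p13 (R : realType) (alpha : R)
    (alpha_gt0 : 0 < alpha) (alpha_lt1 : alpha < 1) :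
  comeager [set f : holder1 alpha_gt0 |
    forall (A : set R) (A01 : A `<=` `[0, 1]%classic),
      (forall beta : R, alpha < beta -> beta <= 1 ->
        holder_on beta (f \o set_incl A01) ->
        (hausdorff_dim A <= (1 - beta)%:E)%E)
      /\
      (forall beta : R, 0 < beta ->
        (power_variation beta (f \o set_incl A01) < +oo)%E ->
        (hausdorff_dim A
           <= (Num.max (alpha * beta) (beta / (beta + 1)))%:E)%E)].
Proof.
pose P (i : rat * rat * nat) : set (holder1 alpha_gt0) :=
  if [&& 0 < ratr i.1.1 :> R, alpha < ratr i.1.2 & ratr i.1.2 < 1 :> R]
  then multi_steep (ratr i.1.1) (ratr i.1.2) i.2 else setT.
apply: (@comeager_bigcap _ _ P).
  move=> i; rewrite /P; case: ifPn => [/and3P[v0 ala a1]|_].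
    exact: multi_steep_nowhere_dense.
  rewrite setCT /nowhere_dense closure0.
  by apply/seteqP; split=> // x /interior_subset.
move=> f Pf A A01.
have Pm (v a : rat) : 0 < ratr v :> R -> alpha < ratr a -> ratr a < 1 :> R ->
    forall m, multi_steep (ratr v) (ratr a) m f.
  by move=> v0 ala a1 m; have := Pf (v, a, m) I; rewrite /P /= v0 ala a1.
split=> beta.
  move=> ab b1 hf; apply: hausdorff_dim_le; first by rewrite subr_ge0.
  move=> s bs; have [v [a [v0 ala a1 sv vab]]] := holder_parameters alpha_gt0 ab b1 bs.
  have s0 : 0 < s by apply: le_lt_trans bs; rewrite subr_ge0.
  exact: holder_restriction_null alpha_lt1 v0 a1 b1 s0 sv vab (Pm _ _ v0 ala a1) hf.
move=> b0 hf.
have max0 : 0 <= Num.max (alpha * beta) (beta / (beta + 1)).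
  by rewrite le_max (mulr_ge0 (ltW alpha_gt0) (ltW b0)).
apply: hausdorff_dim_le => // s bs.
have s0 : 0 < s by exact: le_lt_trans bs.
move: bs; rewrite gt_max => /andP[abs bs].
have [v [a [v0 ala a1 sv bva]]] :=
  variation_parameters alpha_gt0 alpha_lt1 b0 abs bs.
exact: variation_restriction_null alpha_lt1 v0 b0 s0 sv bva (Pm _ _ v0 ala a1) hf.
Qed.
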